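(* Let $K$ be a real symmetric $n\times n$ matrix and $C$ a real skew-symmetric $n\times n$ matrix, and consider the circulatory system $$\ddot{\mathbf q}+K\mathbf q+C\mathbf q=\mathbf 0,\qquad \mathbf q(t)\in\mathbb{R}^n.$$ If one of the following inequalities holds: (i) $n(\|K\|^2-\|C\|^2)<\operatorname{Tr}^2(K)$; (ii) $n\big(\|K^2\|^2+\|C^2\|^2-4\|KC\|^2+2\operatorname{Tr}((KC)^2)\big)<(\|K\|^2-\|C\|^2)^2$; (iii) $(\|K\|^2-\|C\|^2)\big(\|K^2\|^2+\|C^2\|^2-4\|KC\|^2+2\operatorname{Tr}((KC)^2)\big)<\big(\operatorname{Tr}(K^3)+3\operatorname{Tr}(KC^2)\big)^2$, then the equilibrium point $\mathbf q=\mathbf 0,\ \dot{\mathbf q}=\mathbf 0$ of this system is unstable.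
   Context: For a real matrix $A=[a_{ij}]$, $\|A\|^2=\sum_{i,j}a_{ij}^2=\operatorname{Tr}(AA^T)$ (Frobenius norm). $\operatorname{Tr}^2(A)$ means $(\operatorname{Tr}(A))^2$. ''Unstable'' means not stable in the sense of Lyapunov, for the associated first-order linear system in the variables $(\mathbf q,\dot{\mathbf q})\in\mathbb{R}^{2n}$. *)

(* Defs.v *)
From HB Require Import structures.
From mathcomp Require Import all_boot all_order all_algebra.
From mathcomp Require Import all_classical all_reals all_analysis.

Set Implicit Arguments.
Unset Strict Implicit.
Unset Printing Implicit Defensive.

Import Order.TTheory GRing.Theory Num.Theory.
Import numFieldNormedType.Exports.
Local Open Scope ring_scope.

(* The library's norm `|A| on matrices is the sup norm, hence this definition.
   On column vectors it is the Euclidean norm. *)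
Definition normF (R : realType) (m n : nat) (A : 'M[R]_(m, n)) : R :=
  Num.sqrt (\sum_i \sum_j A i j ^+ 2).

(* With x = (q, q'), the system x' = phase_mx B x is q'' + B q = 0. *)
Definition phase_mx (R : realType) (n : nat) (B : 'M[R]_n) : 'M[R]_(n + n) :=
  block_mx 0 1%:M (- B) 0.

(* Solutions are taken on the whole line: every solution of a linear system
   with constant coefficients extends there. *)
Definition linear_solution (R : realType) (N : nat) (M : 'M[R]_N)
    (x : R -> 'cV[R]_N) : Prop :=
  forall t : R, is_derive t (1 : R) x (M *m x t).

Definition lyapunov_stable0 (R : realType) (N : nat) (M : 'M[R]_N) : Prop :=
  forall eps : R, 0 < eps -> exists2 delta : R, 0 < delta &
    forall x : R -> 'cV[R]_N, linear_solution M x ->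
      normF (x 0) < delta -> forall t : R, 0 <= t -> normF (x t) < eps.

(* Main.v *)
Require Import Defs.
From HB Require Import structures.
From mathcomp Require Import all_boot all_order all_algebra.
From mathcomp Require Import all_classical all_reals all_analysis.
From mathcomp Require Import complex ring lra.

Set Implicit Arguments.
Unset Strict Implicit.
Unset Printing Implicit Defensive.

Import Order.TTheory GRing.Theory Num.Theory.
Import numFieldNormedType.Exports.
Local Open Scope ring_scope.

(** Put B = K + C.  Stability forces every complex eigenvalue mu of B to be
    real: if mu is not real, then neither is - mu, so its square roots have
    nonzero real parts of opposite signs, and the root lam with positive real
    part is an eigenvalue of the phase matrix.  The real and imaginary parts
    of exp (lam t) z, where z is an eigenvector, are solutions of which at
    least one leaves every ball, however small their common initial scale
    ([growing_eigenvector_unstable], [stable_real_spectrum]).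

    When the spectrum of B consists of reals r_1, ..., r_n, triangularising B
    over the complex numbers shows that the trace of B ^ k is the power sum
    of the r_i ^ k.  The Cauchy-Schwarz inequality for the families r_i ^ j
    and r_i ^ k then reads

      (tr B ^ (j + k)) ^ 2 <= tr B ^ (2 j) * tr B ^ (2 k)

    ([real_spectrum_sqr_mxtraceX_le]).  The three hypotheses of the theorem
    are the strict opposites of this inequality for (j, k) = (0, 1), (0, 2)
    and (1, 2), once the traces of the powers of K + C are expressed through
    K and C.  In these expressions the words in K and C with an odd number of
    letters C disappear, because the trace of the product of a symmetric and
    a skew-symmetric matrix is zero ([mxtrace_sym_skew]). *)

(** * Traces of powers of a matrix with real spectrum *)

(** Lagrange's identity: the difference of the two sides is half of the sum
    over i and j of (a i * b j - a j * b i) ^+ 2. *)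
Lemma sqr_sum_mul_le (R : realDomainType) (I : finType) (a b : I -> R) :
  (\sum_i a i * b i) ^+ 2 <= (\sum_i a i ^+ 2) * (\sum_i b i ^+ 2).
Proof.
have: 0 <= \sum_i \sum_j (a i * b j - a j * b i) ^+ 2.
  by apply: sumr_ge0 => i _; apply: sumr_ge0 => j _; exact: sqr_ge0.
have -> : \sum_i \sum_j (a i * b j - a j * b i) ^+ 2 =
  \sum_i \sum_j a i ^+ 2 * b j ^+ 2 + \sum_i \sum_j b i ^+ 2 * a j ^+ 2
  - 2 * \sum_i \sum_j (a i * b i) * (a j * b j).
  rewrite mulr_sumr -big_split -sumrB; apply: eq_bigr => i _ /=.
  rewrite mulr_sumr -big_split -sumrB; apply: eq_bigr => j _ /=.
  by ring.
by rewrite -!big_distrlr /= => ?; nra.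
Qed.

Lemma is_trig_mxX (R : pzRingType) (n : nat) (T : 'M[R]_n) (k : nat) :
  is_trig_mx T ->
  is_trig_mx (T ^+ k) /\ forall i, (T ^+ k) i i = T i i ^+ k.
Proof.
move=> /is_trig_mxP T_trig; elim: k => [|k [/is_trig_mxP IHt IHd]].
  split; last by move=> i; rewrite !expr0 mxE eqxx.
  by apply/is_trig_mxP => i j ltij; rewrite expr0 mxE -val_eqE /= ltn_eqF.
split=> [|i].
  apply/is_trig_mxP => i j ltij; rewrite exprS mxE big1 // => l _.
  have [ltil|leli] := ltnP i l; first by rewrite T_trig ?mul0r.
  by rewrite IHt ?mulr0 //; exact: leq_ltn_trans ltij.
rewrite !exprS mxE (bigD1 i) //= IHd big1 ?addr0 // => l neqli.
have [ltil|leli] := ltnP i l; first by rewrite T_trig ?mul0r.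
by rewrite IHt ?mulr0 // ltn_neqAle neqli.
Qed.

Lemma map_mxX (aR rR : pzRingType) (f : {rmorphism aR -> rR}) (n : nat)
  (A : 'M[aR]_n) (k : nat) : map_mx f (A ^+ k) = (map_mx f A) ^+ k.
Proof.
elim: k => [|k IHk]; first by rewrite !expr0 map_mx1.
by rewrite !exprS -IHk; exact: map_mxM.
Qed.

Lemma conj_mxX (F : fieldType) (n : nat) (P A : 'M[F]_n) (k : nat) :
  P \in unitmx -> (P *m A *m invmx P) ^+ k = P *m A ^+ k *m invmx P.
Proof.
move=> Punit; elim: k => [|k IHk]; first by rewrite !expr0 mulmx1 mulmxV.
rewrite !exprS IHk -[LHS]/((P *m A *m invmx P) *m (P *m A ^+ k *m invmx P)).
by rewrite !mulmxA mulmxKV // -[in RHS]mulmxA.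
Qed.

Lemma trig_mx_diag_eigenvector (F : fieldType) (n : nat) (T : 'M[F]_n)
  (i : 'I_n) :
  is_trig_mx T -> exists2 v : 'cV[F]_n, v != 0 & T *m v = T i i *: v.
Proof.
move=> T_trig.
have det0 : \det (T - (T i i)%:M)^T == 0.
  have trig : is_trig_mx (T - (T i i)%:M).
    apply/is_trig_mxP => j k ltjk; move/is_trig_mxP: T_trig => T_trig.
    by rewrite !mxE T_trig // -val_eqE /= ltn_eqF // mulr0n subr0.
  by rewrite det_tr det_trig // (bigD1 i) //= !mxE eqxx subrr mul0r.
case/det0P: det0 => v v0 vT; exists v^T; first by rewrite trmx_eq0.
apply/eqP; rewrite -subr_eq0 -mul_scalar_mx -mulmxBl; apply/eqP.
by apply: trmx_inj; rewrite trmx_mul trmxK vT trmx0.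
Qed.

(** Stated with column eigenvectors, since these are what generates solutions
    of the differential equation; [eigenvalue] is about row eigenvectors. *)
Definition real_spectrum (R : rcfType) (n : nat) (B : 'M[R]_n) : Prop :=
  forall (mu : R[i]) (v : 'cV[R[i]]_n),
    v != 0 -> map_mx (real_complex R) B *m v = mu *: v -> complex.Im mu = 0.

(** The r i are the diagonal entries of a triangular matrix similar to B over
    the complex numbers; these entries are eigenvalues of B, hence real. *)
Lemma real_spectrum_mxtraceX (R : rcfType) (n : nat) (B : 'M[R]_n) :
  real_spectrum B -> exists r : 'I_n -> R,
    forall k, \tr (B ^+ k) = \sum_i r i ^+ k.
Proof.
move=> B_real; set A := map_mx (real_complex R) B.
have [|P P_unitary] := @cotrigonalization _ _ [:: A].
  by move=> X Y; rewrite !inE => /eqP-> /eqP->.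
have Punit := unitarymx_unit P_unitary.
rewrite /= andbT /similar_to conjumx // => T_trig.
set T := P *m A *m invmx P in T_trig.
have T_real i : T i i = real_complex R (complex.Re (T i i)).
  have [v v0 Tv] := trig_mx_diag_eigenvector i T_trig.
  have ImT0 : complex.Im (T i i) = 0.
    apply: (B_real _ (invmx P *m v)).
      by apply: contra_neq v0 => Pv0; rewrite -(mulKVmx Punit v) Pv0 mulmx0.
    by rewrite scalemxAr -Tv /T -!mulmxA mulKmx.
  by rewrite [LHS]complexE ImT0 mulr0 addr0.
exists (fun i => complex.Re (T i i)) => k.
apply: (@complexI R); transitivity (\tr (T ^+ k)).
  by rewrite conj_mxX // mxtrace_mulC mulKmx // -map_mxX trace_map_mx.
rewrite rmorph_sum; apply: eq_bigr => i _; rewrite (is_trig_mxX k T_trig).2.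
by rewrite T_real -rmorphXn.
Qed.

(** Cauchy-Schwarz for the power sums of the eigenvalues. *)
Lemma real_spectrum_sqr_mxtraceX_le (R : rcfType) (n : nat) (B : 'M[R]_n)
  (j k : nat) :
  real_spectrum B ->
  \tr (B ^+ (j + k)) ^+ 2 <= \tr (B ^+ (j + j)) * \tr (B ^+ (k + k)).
Proof.
move=> /real_spectrum_mxtraceX[r trB].
have trM l m : \tr (B ^+ (l + m)) = \sum_i r i ^+ l * r i ^+ m.
  by rewrite trB; apply: eq_bigr => i _; rewrite exprD.
by rewrite !trM; exact: sqr_sum_mul_le.
Qed.

(** * Traces of powers of the sum of a symmetric and a skew-symmetric matrix *)

Lemma normF_sqr (R : realType) (m n : nat) (A : 'M[R]_(m, n)) :
  normF A ^+ 2 = \tr (A *m A^T).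
Proof.
rewrite sqr_sqrtr; last first.
  by apply: sumr_ge0 => i _; apply: sumr_ge0 => j _; exact: sqr_ge0.
by apply: eq_bigr => i _; rewrite mxE; apply: eq_bigr => j _; rewrite mxE expr2.
Qed.

Lemma normF_sqr_col (R : realType) (m : nat) (X : 'cV[R]_m) :
  normF X ^+ 2 = \sum_i X i ord0 ^+ 2.
Proof.
by rewrite normF_sqr; apply: eq_bigr => i _; rewrite mxE big_ord1 mxE expr2.
Qed.

(** Transposing the product and permuting its factors changes the sign of the
    trace. *)
Lemma mxtrace_sym_skew (R : realDomainType) (n : nat) (S A : 'M[R]_n) :
  S^T = S -> A^T = - A -> \tr (S *m A) = 0.
Proof.
move=> S_sym A_skew.
have: \tr (S *m A) = - \tr (S *m A).
  rewrite -[LHS]mxtrace_tr trmx_mul S_sym A_skew mulNmx raddfN /=.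
  by rewrite mxtrace_mulC.
by lra.
Qed.

(** The symmetric and skew-symmetric parts of (K + C) ^+ 2 (see
    [sym_part_sqr] and [skew_part_sqr]): splitting along them removes the odd
    words from the higher powers a whole product at a time. *)
Lemma sqr_sym_skew_split (R : realType) (n : nat) (K C : 'M[R]_n) :
  (K + C) *m (K + C) = (K *m K + C *m C) + (K *m C + C *m K).
Proof. by rewrite mulmxDl !mulmxDr [C *m K + C *m C]addrC addrACA. Qed.

Lemma sym_part_sqr (R : realType) (n : nat) (K C : 'M[R]_n) :
  K^T = K -> C^T = - C -> (K *m K + C *m C)^T = K *m K + C *m C.
Proof.
move=> K_sym C_skew.
by rewrite linearD /= !trmx_mul K_sym C_skew !(mulNmx, mulmxN) opprK.
Qed.

Lemma skew_part_sqr (R : realType) (n : nat) (K C : 'M[R]_n) :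
  K^T = K -> C^T = - C -> (K *m C + C *m K)^T = - (K *m C + C *m K).
Proof.
move=> K_sym C_skew.
by rewrite linearD /= !trmx_mul K_sym C_skew !(mulNmx, mulmxN) opprD addrC.
Qed.

Lemma mxtrace_sqr_sym_skew (R : realType) (n : nat) (K C : 'M[R]_n) :
  K^T = K -> C^T = - C ->
  \tr ((K + C) ^+ 2) = normF K ^+ 2 - normF C ^+ 2.
Proof.
move=> K_sym C_skew.
rewrite !normF_sqr K_sym C_skew mulmxN raddfN /= opprK.
rewrite expr2 -[_ * _]/((K + C) *m (K + C)) sqr_sym_skew_split !mxtraceD.
by rewrite [\tr (C *m K)]mxtrace_mulC (mxtrace_sym_skew K_sym C_skew) !addr0.
Qed.

Lemma mxtrace_cube_sym_skew (R : realType) (n : nat) (K C : 'M[R]_n) :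
  K^T = K -> C^T = - C ->
  \tr ((K + C) ^+ 3) = \tr (K ^+ 3) + 3 * \tr (K *m C ^+ 2).
Proof.
move=> K_sym C_skew.
have sqr_sym := sym_part_sqr K_sym C_skew.
have sqr_skew := skew_part_sqr K_sym C_skew.
have X3 (X : 'M[R]_n) : X ^+ 3 = X *m (X *m X) by rewrite !exprS mulr1.
rewrite !X3 sqr_sym_skew_split expr2 -[C * C]/(C *m C).
rewrite mulmxDl !(mulmxDr _ (_ + _)) !mxtraceD.
rewrite (mxtrace_sym_skew K_sym sqr_skew).
rewrite [\tr (C *m (K *m K + C *m C))]mxtrace_mulC.
rewrite (mxtrace_sym_skew sqr_sym C_skew) !mulmxDr !mxtraceD.
have -> : \tr (C *m (K *m C)) = \tr (K *m (C *m C)).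
  by rewrite mxtrace_mulC mulmxA.
have -> : \tr (C *m (C *m K)) = \tr (K *m (C *m C)).
  by rewrite mulmxA mxtrace_mulC.
by ring.
Qed.

(** After the odd words are gone, those with two letters K and two letters C
    fall into two classes under cyclic permutation: four words equivalent to
    K K C C, with trace - normF (K *m C) ^+ 2, and two equivalent to
    K C K C. *)
Lemma mxtrace_fourth_sym_skew (R : realType) (n : nat) (K C : 'M[R]_n) :
  K^T = K -> C^T = - C ->
  \tr ((K + C) ^+ 4) =
  normF (K ^+ 2) ^+ 2 + normF (C ^+ 2) ^+ 2
  - 4 * normF (K *m C) ^+ 2 + 2 * \tr ((K *m C) ^+ 2).
Proof.
move=> K_sym C_skew.
have sqr_sym := sym_part_sqr K_sym C_skew.
have sqr_skew := skew_part_sqr K_sym C_skew.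
have X2 (X : 'M[R]_n) : X ^+ 2 = X *m X by [].
have X4 (X : 'M[R]_n) : X ^+ 4 = (X *m X) *m (X *m X).
  by rewrite (exprM X 2 2) !X2.
rewrite !normF_sqr X4 sqr_sym_skew_split !X2 !trmx_mul K_sym C_skew.
rewrite !(mulNmx, mulmxN) opprK raddfN /=.
rewrite mulmxDl !(mulmxDr (_ + _) (K *m K + C *m C)) !mxtraceD.
rewrite (mxtrace_sym_skew sqr_sym sqr_skew).
rewrite [\tr ((K *m C + C *m K) *m (K *m K + C *m C))]mxtrace_mulC.
rewrite (mxtrace_sym_skew sqr_sym sqr_skew) !(mulmxDl, mulmxDr, mxtraceD).
set k2c2 := \tr (K *m K *m (C *m C)).
have -> : \tr (C *m C *m (K *m K)) = k2c2 by rewrite mxtrace_mulC.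
have -> : \tr (K *m C *m (C *m K)) = k2c2.
  by rewrite mulmxA mxtrace_mulC /k2c2 !mulmxA.
have -> : \tr (C *m K *m (K *m C)) = k2c2.
  by rewrite -mulmxA mxtrace_mulC /k2c2 !mulmxA.
have -> : \tr (C *m K *m (C *m K)) = \tr (K *m C *m (K *m C)).
  by rewrite -mulmxA mxtrace_mulC !mulmxA.
by ring.
Qed.

(** * Instability from a growing complex mode *)

(** With lam = alpha + i beta and z = U + i W, the hypotheses on U and W say
    that M z = lam z, and the solution is the real part of exp (lam t) z. *)
Lemma rotating_solution (R : realType) (N : nat) (M : 'M[R]_N)
  (alpha beta : R) (U W : 'cV[R]_N) :
  M *m U = alpha *: U - beta *: W -> M *m W = beta *: U + alpha *: W ->
  linear_solution M (fun t => expR (alpha * t) *: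
                              (cos (beta * t) *: U - sin (beta * t) *: W)).
Proof.
move=> MU MW t; set x := fun t => _.
have dx i j : is_derive t (1 : R) (fun s => x s i j) ((M *m x t) i j).
  have -> : (fun s => x s i j) = (fun s => expR (alpha * s) *
      (cos (beta * s) * U i j - sin (beta * s) * W i j)).
    by apply/funext => s; rewrite /x !mxE.
  have dl (c : R) : is_derive t (1 : R) (fun s => c * s) c.
    by apply: is_derive_eq; rewrite /GRing.scale /= mulr1.
  have de := @is_derive1_comp _ expR _ t _ _ (is_derive_expR _) (dl alpha).
  have dc := @is_derive1_comp _ cos _ t _ _ (is_derive_cos _) (dl beta).
  have ds := @is_derive1_comp _ sin _ t _ _ (is_derive_sin _) (dl beta).
  have -> : (M *m x t) i j = expR (alpha * t) *
      (cos (beta * t) * (alpha * U i j - beta * W i j)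
       - sin (beta * t) * (beta * U i j + alpha * W i j)).
    by rewrite /x -scalemxAr mulmxBr -!scalemxAr MU MW !mxE.
  have := @is_deriveM _ _ _ _ t 1 _ _ de (@is_deriveB _ _ _ _ _ t 1 _ _
    (@is_deriveM _ _ _ _ t 1 _ _ dc (@is_derive_cst _ _ _ (U i j) t 1))
    (@is_deriveM _ _ _ _ t 1 _ _ ds (@is_derive_cst _ _ _ (W i j) t 1))).
  move=> /is_derive_eq; apply; rewrite /GRing.scale /= !fctE /=.
  by ring.
have dM : derivable x t 1 by apply/derivable_mxP => i j; have [] := dx i j.
apply: DeriveDef => //; rewrite derive_mx //.
by apply/matrixP => i j; rewrite mxE; have [_ ->] := dx i j.
Qed.

(** The real and imaginary parts of exp (lam t) z, scaled by s: separately
    they oscillate, but their joint squared norm is an exact exponential. *)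
Lemma rotating_pair_normF_sqr (R : realType) (N : nat) (alpha beta s t : R)
  (U W : 'cV[R]_N) :
  normF (s *: (expR (alpha * t) *:
               (cos (beta * t) *: U - sin (beta * t) *: W))) ^+ 2
  + normF (s *: (expR (alpha * t) *:
                 (cos (beta * t) *: W + sin (beta * t) *: U))) ^+ 2
  = s ^+ 2 * expR (2 * (alpha * t)) * (normF U ^+ 2 + normF W ^+ 2).
Proof.
rewrite !normF_sqr_col -!big_split mulr_sumr; apply: eq_bigr => i _ /=.
rewrite !mxE expRM_natl /=.
have := cos2Dsin2 (beta * t).
move: (cos _) (sin _) (expR _) (U _ _) (W _ _) => c d e u w cd.
by rewrite -[e ^+ 2]mulr1 -cd; ring.
Qed.

Lemma growing_eigenvector_unstable (R : realType) (N : nat) (M : 'M[R]_N)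
  (lam : R[i]) (z : 'cV[R[i]]_N) :
  z != 0 -> map_mx (real_complex R) M *m z = lam *: z ->
  0 < complex.Re lam -> ~ lyapunov_stable0 M.
Proof.
move=> z0 Mz; case: lam Mz => alpha beta Mz /= alpha_gt0 M_stable.
pose U := map_mx (@complex.Re R) z; pose W := map_mx (@complex.Im R) z.
have Mz_ij i j :
    \sum_k M i k * complex.Re (z k j)
      = alpha * complex.Re (z i j) - beta * complex.Im (z i j)
    /\ \sum_k M i k * complex.Im (z k j)
      = alpha * complex.Im (z i j) + beta * complex.Re (z i j).
  have /matrixP/(_ i j) := Mz.
  rewrite !mxE => eq_ij.
  have ReS (I : finType) (F : I -> R[i]) :
      complex.Re (\sum_k F k) = \sum_k complex.Re (F k).
    by apply: (big_morph (@complex.Re R)) => // -[? ?] [? ?].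
  have ImS (I : finType) (F : I -> R[i]) :
      complex.Im (\sum_k F k) = \sum_k complex.Im (F k).
    by apply: (big_morph (@complex.Im R)) => // -[? ?] [? ?].
  have := congr1 (@complex.Re R) eq_ij; have := congr1 (@complex.Im R) eq_ij.
  rewrite ReS ImS; case: (z i j) => p q /= <- <-.
  split; apply: eq_bigr => k _; rewrite mxE;
    by case: (z k j) => a b /=; rewrite mul0r ?subr0 ?addr0.
have MU : M *m U = alpha *: U - beta *: W.
  apply/matrixP => i j; rewrite !mxE -(Mz_ij i j).1.
  by apply: eq_bigr => k _; rewrite !mxE.
have MW : M *m W = beta *: U + alpha *: W.
  apply/matrixP => i j; rewrite !mxE addrC -(Mz_ij i j).2.
  by apply: eq_bigr => k _; rewrite !mxE.
set E := normF U ^+ 2 + normF W ^+ 2.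
have E_gt0 : 0 < E.
  rewrite lt0r addr_ge0 ?sqr_ge0 // andbT; apply: contra z0.
  rewrite paddr_eq0 ?sqr_ge0 // !normF_sqr_col.
  rewrite !psumr_eq0 => [|i _|i _]; try exact: sqr_ge0.
  move=> /andP[/allP U0 /allP W0]; apply/eqP/matrixP => i j; rewrite [j]ord1.
  have := U0 i (mem_index_enum i); have := W0 i (mem_index_enum i).
  rewrite !sqrf_eq0 !mxE => /eqP im0 /eqP re0.
  by case: (z i ord0) re0 im0 => p q /= -> ->.
have [delta delta_gt0 stab] := M_stable 1 ltr01.
(* The joint squared norm at time 0 is s ^+ 2 * E; dividing by 1 + E makes it
   less than delta ^+ 2 because E < (1 + E) ^+ 2. *)
pose s := delta / (1 + E).
have s_gt0 : 0 < s by rewrite divr_gt0 // addr_gt0.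
have sE : s ^+ 2 * E < delta ^+ 2.
  rewrite /s expr_div_n -mulrA gtr_pMr ?exprn_gt0 // mulrC.
  rewrite ltr_pdivrMr; last by rewrite exprn_gt0 // addr_gt0.
  by nra.
have sol (U' W' : 'cV[R]_N) : M *m U' = alpha *: U' - beta *: W' ->
    M *m W' = beta *: U' + alpha *: W' ->
    linear_solution M (fun t => s *: (expR (alpha * t) *:
                              (cos (beta * t) *: U' - sin (beta * t) *: W'))).
  move=> MU' MW' t; rewrite -scalemxAr.
  exact/is_deriveZ/(rotating_solution MU' MW').
pose x t : 'cV[R]_N :=
  s *: (expR (alpha * t) *: (cos (beta * t) *: U - sin (beta * t) *: W)).
pose y t : 'cV[R]_N :=
  s *: (expR (alpha * t) *: (cos (beta * t) *: W + sin (beta * t) *: U)).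
have x_sol : linear_solution M x by exact: sol.
have y_sol : linear_solution M y.
  (* The imaginary part of exp (lam t) z is the real part for the eigenvector
     - i z = W - i U. *)
  have -> : y = fun t => s *: (expR (alpha * t) *:
                         (cos (beta * t) *: W - sin (beta * t) *: - U)).
    by apply/funext => t; rewrite scalerN opprK.
  by apply: sol; rewrite ?mulmxN ?MU ?MW ?scalerN ?opprK ?opprB 1?addrC.
have joint t : normF (x t) ^+ 2 + normF (y t) ^+ 2
    = s ^+ 2 * expR (2 * (alpha * t)) * E.
  exact: rotating_pair_normF_sqr.
have nF_ge0 (X : 'cV[R]_N) : 0 <= normF X by exact: sqrtr_ge0.
have sqr_lt (a b : R) : 0 <= a -> 0 <= b -> a ^+ 2 < b ^+ 2 -> a < b.
  by move=> a0 b0; rewrite ltr_pXn2r.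
have joint0 := joint 0; rewrite !mulr0 expR0 mulr1 in joint0.
have x0 : normF (x 0) < delta.
  apply: sqr_lt => //; [exact: ltW|apply: le_lt_trans sE].
  by rewrite -joint0 lerDl sqr_ge0.
have y0 : normF (y 0) < delta.
  apply: sqr_lt => //; [exact: ltW|apply: le_lt_trans sE].
  by rewrite -joint0 lerDr sqr_ge0.
(* At this time, exp u >= 1 + u already gives a joint squared norm >= 2,
   whereas stability bounds each of the two terms by 1. *)
pose T := (alpha * (s ^+ 2 * E))^-1.
have sE_gt0 : 0 < s ^+ 2 * E by rewrite mulr_gt0 ?exprn_gt0.
have T_ge0 : 0 <= T by rewrite invr_ge0 mulr_ge0 ?ltW.
have xT := stab x x_sol x0 T T_ge0.
have yT := stab y y_sol y0 T T_ge0.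
have alphaT : alpha * T = (s ^+ 2 * E)^-1.
  by rewrite /T invfM mulrA mulfV ?mul1r // gt_eqF.
have := expR_ge1Dx (2 * (alpha * T)).
have := joint T.
rewrite alphaT; set e := expR _ => eT e_ge.
have : 2 <= s ^+ 2 * e * E.
  rewrite mulrAC -ler_pdivrMl // mulrC; apply: le_trans e_ge.
  by rewrite lerDr.
have xx : normF (x T) ^+ 2 < 1 by rewrite expr_lt1.
have yy : normF (y T) ^+ 2 < 1 by rewrite expr_lt1.
by lra.
Qed.

(** An eigenvector v of B for mu gives the eigenvector (v, lam v) of the phase
    matrix for each square root lam of - mu.  A purely imaginary lam has a
    real square, so for nonreal mu one of the two roots has positive real
    part. *)
Lemma stable_real_spectrum (R : realType) (n : nat) (B : 'M[R]_n) :
  lyapunov_stable0 (phase_mx B) -> real_spectrum B.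
Proof.
move=> B_stable mu v v0 Bv; apply/eqP; apply/negPn/negP => mu_nonreal.
have [lam lam2 Re_lam] :
    exists2 lam : R[i], lam ^+ 2 = - mu & 0 < complex.Re lam.
  set w := sqrtc (- mu); have w2 : w ^+ 2 = - mu by exact: sqr_sqrtc.
  have : complex.Re w != 0.
    apply: contra mu_nonreal => /eqP Re0; move: w2; clearbody w.
    case: w Re0 => p q /= ->; case: (mu) => a b.
    rewrite expr2 => -[_]; rewrite mul0r mulr0 addr0 => /esym/eqP.
    by rewrite oppr_eq0.
  rewrite neq_lt => /orP[w_lt0|w_gt0]; last by exists w.
  exists (- w); first by rewrite sqrrN.
  by clear w2; clearbody w; case: w w_lt0 => p q /=; rewrite oppr_gt0.
apply: (@growing_eigenvector_unstable _ _ _ lam (col_mx v (lam *: v)) _ _ _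
          B_stable) => //.
  by apply: contra v0; rewrite col_mx_eq0 => /andP[].
rewrite /phase_mx map_block_mx !map_mx0 map_mx1 map_mxN mul_block_col.
rewrite !mul0mx mul1mx add0r addr0 mulNmx Bv.
by rewrite scale_col_mx scalerA -expr2 lam2 scaleNr.
Qed.

(** * The instability criteria *)

Theorem theorem3p1 (R : realType) (n : nat) (K C : 'M[R]_n)
  (K_sym : K^T = K) (C_skew : C^T = - C) :
  [\/ n%:R * (normF K ^+ 2 - normF C ^+ 2) < (\tr K) ^+ 2,
      n%:R * (normF (K ^+ 2) ^+ 2 + normF (C ^+ 2) ^+ 2
              - 4 * normF (K *m C) ^+ 2 + 2 * \tr ((K *m C) ^+ 2))
        < (normF K ^+ 2 - normF C ^+ 2) ^+ 2
    | (normF K ^+ 2 - normF C ^+ 2)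
        * (normF (K ^+ 2) ^+ 2 + normF (C ^+ 2) ^+ 2
           - 4 * normF (K *m C) ^+ 2 + 2 * \tr ((K *m C) ^+ 2))
        < (\tr (K ^+ 3) + 3 * \tr (K *m C ^+ 2)) ^+ 2] ->
  ~ lyapunov_stable0 (phase_mx (K + C)).
Proof.
have tr0 : \tr ((K + C) ^+ 0) = n%:R by rewrite expr0 mxtrace1.
have tr1 : \tr ((K + C) ^+ 1) = \tr K.
  have trC0 : \tr C = 0 by rewrite -[C]mul1mx mxtrace_sym_skew ?trmx1.
  by rewrite expr1 mxtraceD trC0 addr0.
have tr2 := mxtrace_sqr_sym_skew K_sym C_skew.
have tr3 := mxtrace_cube_sym_skew K_sym C_skew.
have tr4 := mxtrace_fourth_sym_skew K_sym C_skew.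
rewrite -tr0 -tr1 -tr2 -tr3 -tr4 => ineq /stable_real_spectrum B_real.
have CS j k := real_spectrum_sqr_mxtraceX_le j k B_real.
case: ineq; rewrite ltNge => /negP; apply;
  by [exact: (CS 0 1)|exact: (CS 0 2)|exact: (CS 1 2)].
Qed.
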